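(* Let $\mathcal{K}$ be a 2-category, $\mathcal{C}$ a 0-cell, $T:\mathcal{C}\to\mathcal{C}$ a 1-cell, and $\mu:T^2\Rightarrow T$, $\eta:I\Rightarrow T$ 2-cells, where $I$ is the identity 1-cell on $\mathcal{C}$. The following are equivalent: (1) $\mu\circ\mu T=\mu\circ T\mu$ and $\mu\circ\eta T=\mu\circ T\eta=\mathrm{id}_T$; (2) $T$ is a terminal object in the rewrite category with objects all strings $T^n$ ($n\ge 0$, with $T^0=I$ the empty string) and rewrite rules $\mu$ and $\eta$; that is, for every $n\ge 0$ there exists a derivation from $T^n$ to $T$, and any two derivations from $T^n$ to $T$ have the same value.
   Context: Juxtaposition of 1-cells denotes composition, $\circ$ denotes vertical composition of 2-cells, and for 1-cells $A,B$ and a 2-cell $\phi:F\Rightarrow G$, $A\phi B:AFB\Rightarrow AGB$ denotes the whiskering of $\phi$ by the identity 2-cells on $A$ and $B$. Objects of the rewrite category are formal strings over the letter $T$. A reduction replaces an occurrence of the left side of a rule inside a string by its right side: either $T^aT^2T^b\to T^aTT^b$ with 2-cell $T^a\mu T^b$, or $T^aT^b\to T^aTT^b$ (inserting a $T$ at any position) with 2-cell $T^a\eta T^b$, for $a,b\geq 0$. A derivation from one string to another is a finite (possibly empty) sequence of reductions; its value is the vertical composite in $\mathcal{K}$ of the 2-cells of its reductions (identity for the empty derivation). Morphisms of the rewrite category are values of derivations. *)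

(* Defs.v *)
From Stdlib Require Import Arith ProofIrrelevance.

Set Implicit Arguments.
Unset Strict Implicit.
Unset Printing Implicit Defensive.

Declare Scope cell_scope.
Open Scope cell_scope.

Record category := Category {
  obj :> Type;
  mor : obj -> obj -> Type;
  idm : forall x, mor x x;
  comp : forall x y z, mor y z -> mor x y -> mor x z;
  comp_idl : forall x y (f : mor x y), comp (idm y) f = f;
  comp_idr : forall x y (f : mor x y), comp f (idm x) = f;
  comp_assoc : forall x y z w (h : mor z w) (g : mor y z) (f : mor x y),
    comp h (comp g f) = comp (comp h g) f
}.

Arguments mor {c} x y.
Arguments idm {c} x.
Arguments comp {c x y z} g f.

Notation "g \o f" := (comp g f)
  (at level 50, left associativity) : cell_scope.

Definition terminal (X : category) (t : X) : Prop :=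
  forall x : X, exists f : mor x t, forall g : mor x t, g = f.

(* Since 1-cell composition is only propositionally associative and unital,
   2-cells whose boundaries are equal 1-cells are compared through [cast]. *)
Definition cast (X : category) (x x' y y' : X) (ex : x = x') (ey : y = y')
    (f : mor x y) : mor x' y' :=
  match ex in _ = a, ey in _ = b return mor a b with
  | eq_refl, eq_refl => f
  end.

(* A strict 2-category, presented as a Cat-enriched category: [cell1 A B] is
   the category of 1-cells A -> B and 2-cells under vertical composition.
   Juxtaposition is in applicative order: [comp1 G F] is "F, then G". *)
Record two_category := TwoCategory {
  cell0 :> Type;
  cell1 : cell0 -> cell0 -> category;
  id1 : forall A, cell1 A A;
  comp1 : forall A B C, cell1 B C -> cell1 A B -> cell1 A C;
  hcomp : forall A B C (G G' : cell1 B C) (F F' : cell1 A B),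
    mor G G' -> mor F F' -> mor (comp1 G F) (comp1 G' F');
  hcomp_id : forall A B C (G : cell1 B C) (F : cell1 A B),
    hcomp (idm G) (idm F) = idm (comp1 G F);
  interchange : forall A B C (G G' G'' : cell1 B C) (F F' F'' : cell1 A B)
    (b' : mor G' G'') (b : mor G G') (a' : mor F' F'') (a : mor F F'),
    hcomp (b' \o b) (a' \o a) = hcomp b' a' \o hcomp b a;
  comp1_idl : forall A B (F : cell1 A B), comp1 (id1 B) F = F;
  comp1_idr : forall A B (F : cell1 A B), comp1 F (id1 A) = F;
  comp1_assoc : forall A B C D
    (H : cell1 C D) (G : cell1 B C) (F : cell1 A B),
    comp1 H (comp1 G F) = comp1 (comp1 H G) F;
  hcomp_idl : forall A B (F F' : cell1 A B) (a : mor F F'),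
    cast (comp1_idl F) (comp1_idl F') (hcomp (idm (id1 B)) a) = a;
  hcomp_idr : forall A B (F F' : cell1 A B) (a : mor F F'),
    cast (comp1_idr F) (comp1_idr F') (hcomp a (idm (id1 A))) = a;
  hcomp_assoc : forall A B C D (H H' : cell1 C D) (G G' : cell1 B C)
    (F F' : cell1 A B) (c : mor H H') (b : mor G G') (a : mor F F'),
    cast (comp1_assoc H G F) (comp1_assoc H' G' F') (hcomp c (hcomp b a))
    = hcomp (hcomp c b) a
}.

Arguments cell1 {t} A B.
Arguments id1 {t} A.
Arguments comp1 {t A B C} G F.
Arguments hcomp {t A B C G G' F F'} b a.

Notation "G ** F" := (comp1 G F)
  (at level 40, left associativity) : cell_scope.

Section Whiskering.

Variables (K : two_category) (A B C D : K).

Definition whiskl (H : cell1 B C) (F G : cell1 A B) (phi : mor F G) :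
  mor (H ** F) (H ** G) := hcomp (idm H) phi.

Definition whiskr (F G : cell1 B C) (phi : mor F G) (H : cell1 A B) :
  mor (F ** H) (G ** H) := hcomp phi (idm H).

End Whiskering.

Definition whisk (K : two_category) (A B C D : K) (H : cell1 C D)
    (F G : cell1 B C) (phi : mor F G) (L : cell1 A B) :
    mor (H ** F ** L) (H ** G ** L) :=
  whiskr (whiskl H phi) L.

(* The formal string T^n is encoded by its length n, so that distinct strings
   remain distinct objects even if they denote equal 1-cells. *)
Inductive reduction : nat -> nat -> Type :=
| red_mu (a b : nat) : reduction (a + 2 + b) (a + 1 + b)
| red_eta (a b : nat) : reduction (a + b) (a + 1 + b).

Inductive derivation : nat -> nat -> Type :=
| der_nil (n : nat) : derivation n n
| der_cons (n m p : nat) :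
    reduction n m -> derivation m p -> derivation n p.

Arguments der_nil n : clear implicits.

Fixpoint der_cat n m p (d : derivation n m) :
    derivation m p -> derivation n p :=
  match d with
  | der_nil _ => fun e => e
  | der_cons r d' => fun e => der_cons r (der_cat d' e)
  end.

Section Rewriting.

Variables (K : two_category) (C : K) (T : cell1 C C).

Fixpoint pow1 (n : nat) : cell1 C C :=
  match n with
  | 0 => id1 C
  | S m => T ** pow1 m
  end.

Lemma pow1_add a b : pow1 a ** pow1 b = pow1 (a + b).
Proof.
induction a as [|a IH]; simpl; [apply comp1_idl|].
now rewrite <- comp1_assoc, IH.
Qed.

Lemma pow1_1 : T = pow1 1.
Proof. symmetry; apply comp1_idr. Qed.

Lemma pow1_2 : T ** T = pow1 2.
Proof. simpl; now rewrite comp1_idr. Qed.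

Lemma pow1_around a n b (F : cell1 C C) :
  F = pow1 n -> pow1 a ** F ** pow1 b = pow1 (a + n + b).
Proof. intros ->; now rewrite !pow1_add. Qed.

Lemma pow1_around_id a b : pow1 a ** id1 C ** pow1 b = pow1 (a + b).
Proof. now rewrite comp1_idr, pow1_add. Qed.

Variables (mu : mor (T ** T) T) (eta : mor (id1 C) T).

Definition red_value n m (r : reduction n m) : mor (pow1 n) (pow1 m) :=
  match r in reduction n m return mor (pow1 n) (pow1 m) with
  | red_mu a b =>
      cast (pow1_around a b pow1_2) (pow1_around a b pow1_1)
        (whisk (pow1 a) mu (pow1 b))
  | red_eta a b =>
      cast (pow1_around_id a b) (pow1_around a b pow1_1)
        (whisk (pow1 a) eta (pow1 b))
  end.

Fixpoint value n m (d : derivation n m) : mor (pow1 n) (pow1 m) :=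
  match d in derivation n m return mor (pow1 n) (pow1 m) with
  | der_nil n => idm (pow1 n)
  | der_cons r d' => value d' \o red_value r
  end.

Lemma value_cat n m p (d : derivation n m) (e : derivation m p) :
  value (der_cat d e) = value e \o value d.
Proof.
induction d as [n|n m q r d IH]; simpl; [now rewrite comp_idr|].
now rewrite IH, comp_assoc.
Qed.

Definition rw_mor (n m : nat) : Type :=
  {phi : mor (pow1 n) (pow1 m) | exists d : derivation n m, value d = phi}.

Lemma rw_mor_eq n m (f g : rw_mor n m) : proj1_sig f = proj1_sig g -> f = g.
Proof.
destruct f as [f Hf], g as [g Hg]; simpl; intros e.
now apply subset_eq_compat.
Qed.

Definition rw_id (n : nat) : rw_mor n n :=
  exist _ (idm (pow1 n)) (ex_intro _ (der_nil n) eq_refl).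

Lemma rw_comp_subproof n m p (g : rw_mor m p) (f : rw_mor n m) :
  exists d : derivation n p, value d = proj1_sig g \o proj1_sig f.
Proof.
destruct g as [g [e <-]], f as [f [d <-]].
exists (der_cat d e); apply value_cat.
Qed.

Definition rw_comp n m p (g : rw_mor m p) (f : rw_mor n m) : rw_mor n p :=
  exist _ (proj1_sig g \o proj1_sig f) (rw_comp_subproof g f).

Lemma rw_comp_idl n m (f : rw_mor n m) : rw_comp (rw_id m) f = f.
Proof. apply rw_mor_eq, comp_idl. Qed.

Lemma rw_comp_idr n m (f : rw_mor n m) : rw_comp f (rw_id n) = f.
Proof. apply rw_mor_eq, comp_idr. Qed.

Lemma rw_comp_assoc n m p q
    (h : rw_mor p q) (g : rw_mor m p) (f : rw_mor n m) :
  rw_comp h (rw_comp g f) = rw_comp (rw_comp h g) f.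
Proof. apply rw_mor_eq, comp_assoc. Qed.

Definition rewrite_category : category :=
  Category rw_comp_idl rw_comp_idr rw_comp_assoc.

Lemma terminal_rewriteP (t : nat) :
  @terminal rewrite_category t <->
  (forall n, inhabited (derivation n t)) /\
  (forall n (d d' : derivation n t), value d = value d').
Proof.
split.
- intros H; split.
  + intros n; destruct (H n) as [[f [d _]] _]; exact (inhabits d).
  + intros n d d'; destruct (H n) as [f Hf].
    pose (i (d : derivation n t) :=
      exist _ (value d) (ex_intro _ d eq_refl) : rw_mor n t).
    change (proj1_sig (i d) = proj1_sig (i d')).
    now rewrite (Hf (i d)), (Hf (i d')).
- intros [He Hu] n; destruct (He n) as [d].
  exists (exist _ (value d) (ex_intro _ d eq_refl)).
  intros [g [d' <-]]; apply rw_mor_eq; apply Hu.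
Qed.

End Rewriting.

(* Main.v *)
(** From (1), put [c 0 = eta] and [c (S n) = mu \o T (c n)].  Associativity and
    the left unit law give [mu \o (c a * c b) = c (a + b)], whence every
    reduction [r : n -> m] satisfies [c m \o r = c n]; as [c 1] is the identity
    by the right unit law, every derivation from [n] to [1] has value [c n].
    Conversely, the two sides of each law are values of parallel derivations
    into [1]. *)

From Stdlib Require Import ProofIrrelevance.
Require Import Defs.

Set Implicit Arguments.
Unset Strict Implicit.
Unset Printing Implicit Defensive.

(** Heterogeneous equality of 2-cells: being a congruence for both compositions, it replaces
    commuting [cast] past each operation. *)
Definition aeq (X : category) (x y x' y' : X) (f : mor x y) (g : mor x' y') :
  Prop := exists (ex : x = x') (ey : y = y'), cast ex ey f = g.

Notation "f =~ g" := (aeq f g) (at level 70, no associativity) : cell_scope.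

Section HeterogeneousEquality.

Variable X : category.

(** Equality of 1-cells is not assumed decidable, so loops are trivialised by proof irrelevance. *)
Lemma cast_id (x y : X) (ex : x = x) (ey : y = y) (f : mor x y) :
  cast ex ey f = f.
Proof.
now rewrite (proof_irrelevance _ ex eq_refl), (proof_irrelevance _ ey eq_refl).
Qed.

Lemma aeq_refl (x y : X) (f : mor x y) : f =~ f.
Proof. now exists eq_refl, eq_refl. Qed.

Lemma eq_aeq (x y : X) (f g : mor x y) : f = g -> f =~ g.
Proof. intros ->; apply aeq_refl. Qed.

Lemma aeq_eq (x y : X) (f g : mor x y) : f =~ g -> f = g.
Proof. intros (ex & ey & <-); now rewrite cast_id. Qed.

Lemma aeq_sym (x y x' y' : X) (f : mor x y) (g : mor x' y') :
  f =~ g -> g =~ f.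
Proof. intros (ex & ey & <-); destruct ex, ey; apply aeq_refl. Qed.

Lemma aeq_trans (x y x' y' x'' y'' : X)
    (f : mor x y) (g : mor x' y') (h : mor x'' y'') :
  f =~ g -> g =~ h -> f =~ h.
Proof. intros (ex & ey & <-); destruct ex, ey; trivial. Qed.

Lemma cast_aeq (x x' y y' : X) (ex : x = x') (ey : y = y') (f : mor x y) :
  cast ex ey f =~ f.
Proof. destruct ex, ey; apply aeq_refl. Qed.

Lemma aeq_idm (x y : X) : x = y -> idm x =~ idm y.
Proof. intros ->; apply aeq_refl. Qed.

Lemma aeq_comp (x y z x' y' z' : X) (g : mor y z) (f : mor x y)
    (g' : mor y' z') (f' : mor x' y') :
  g =~ g' -> f =~ f' -> g \o f =~ g' \o f'.
Proof.
intros (ey & ez & <-) (ex & ey' & <-); destruct ex, ey, ez.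
(* The middle object was identified twice; the second identification [ey'] is now a loop. *)
rewrite (cast_id eq_refl ey'); apply aeq_refl.
Qed.

End HeterogeneousEquality.

Section HorizontalComposition.

Variable K : two_category.

Lemma aeq_hcomp (A B C : K) (G1 G2 G1' G2' : cell1 B C)
    (F1 F2 F1' F2' : cell1 A B) (b : mor G1 G2) (b' : mor G1' G2')
    (a : mor F1 F2) (a' : mor F1' F2') :
  b =~ b' -> a =~ a' -> hcomp b a =~ hcomp b' a'.
Proof.
intros (e1 & e2 & <-) (e3 & e4 & <-); destruct e1, e2, e3, e4; apply aeq_refl.
Qed.

Lemma hcomp_idl_aeq (A B : K) (F F' : cell1 A B) (a : mor F F') :
  hcomp (idm (id1 B)) a =~ a.
Proof. eexists _, _; apply hcomp_idl. Qed.

Lemma hcomp_idr_aeq (A B : K) (F F' : cell1 A B) (a : mor F F') :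
  hcomp a (idm (id1 A)) =~ a.
Proof. eexists _, _; apply hcomp_idr. Qed.

Lemma hcomp_assoc_aeq (A B C D : K) (H H' : cell1 C D) (G G' : cell1 B C)
    (F F' : cell1 A B) (c : mor H H') (b : mor G G') (a : mor F F') :
  hcomp (hcomp c b) a =~ hcomp c (hcomp b a).
Proof. apply aeq_sym; eexists _, _; apply hcomp_assoc. Qed.

End HorizontalComposition.

Section Monad.

Variables (K : two_category) (C : K) (T : cell1 C C).
Variables (mu : mor (T ** T) T) (eta : mor (id1 C) T).

Lemma red_mu_aeq (a b : nat) :
  red_value mu eta (red_mu a b)
  =~ hcomp (hcomp (idm (pow1 T a)) mu) (idm (pow1 T b)).
Proof. apply cast_aeq. Qed.

Lemma red_eta_aeq (a b : nat) :
  red_value mu eta (red_eta a b)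
  =~ hcomp (hcomp (idm (pow1 T a)) eta) (idm (pow1 T b)).
Proof. apply cast_aeq. Qed.

Lemma derivation_to_1 (n : nat) : inhabited (derivation n 1).
Proof.
destruct n as [|n].
(* The empty string needs one insertion; longer strings contract their leftmost pair repeatedly. *)
- exact (inhabits (der_cons (red_eta 0 0) (der_nil 1))).
- induction n as [|n [d]].
  + exact (inhabits (der_nil 1)).
  + exact (inhabits (der_cons (red_mu 0 n) d)).
Qed.

(** * From unique values to the monad laws *)

Lemma around_0_0 (F F' : cell1 C C) (phi : mor F F') :
  hcomp (hcomp (idm (pow1 T 0)) phi) (idm (pow1 T 0)) =~ phi.
Proof.
apply (aeq_trans (hcomp_idr_aeq _)), hcomp_idl_aeq.
Qed.

Lemma around_0_1 (F F' : cell1 C C) (phi : mor F F') :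
  hcomp (hcomp (idm (pow1 T 0)) phi) (idm (pow1 T 1)) =~ hcomp phi (idm T).
Proof.
apply aeq_hcomp; [apply hcomp_idl_aeq|apply aeq_idm, comp1_idr].
Qed.

Lemma around_1_0 (F F' : cell1 C C) (phi : mor F F') :
  hcomp (hcomp (idm (pow1 T 1)) phi) (idm (pow1 T 0)) =~ hcomp (idm T) phi.
Proof.
apply (aeq_trans (hcomp_idr_aeq _)).
apply aeq_hcomp; [apply aeq_idm, comp1_idr|apply aeq_refl].
Qed.

Lemma value_then_mu (n : nat) (F : cell1 C C) (phi : mor F (T ** T))
    (r : reduction n 2) :
  red_value mu eta r =~ phi ->
  value mu eta (der_cons r (der_cons (red_mu 0 0) (der_nil 1))) =~ mu \o phi.
Proof.
intros Hr; simpl; rewrite comp_idl.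
apply aeq_comp; [|exact Hr].
exact (aeq_trans (red_mu_aeq 0 0) (around_0_0 mu)).
Qed.

(** Associativity compares two derivations 3 -> 2 -> 1; each unit law compares a derivation 1 -> 2
    -> 1 with the empty one. *)
Lemma laws_of_value_unique :
  (forall n (d d' : derivation n 1), value mu eta d = value mu eta d') ->
  mu \o hcomp mu (idm T) =~ mu \o hcomp (idm T) mu /\
  mu \o hcomp eta (idm T) =~ idm T /\
  mu \o hcomp (idm T) eta =~ idm T.
Proof.
intros Hu.
pose (then_mu n (r : reduction n 2) :=
  der_cons r (der_cons (red_mu 0 0) (der_nil 1))).
assert (Hid : value mu eta (der_nil 1) =~ idm T) by apply aeq_idm, comp1_idr.
pose proof (value_then_mu (aeq_trans (red_mu_aeq 0 1) (around_0_1 mu))) as Hl.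
pose proof (value_then_mu (aeq_trans (red_mu_aeq 1 0) (around_1_0 mu))) as Hr.
pose proof (value_then_mu (aeq_trans (red_eta_aeq 0 1) (around_0_1 eta))) as Kl.
pose proof (value_then_mu (aeq_trans (red_eta_aeq 1 0) (around_1_0 eta))) as Kr.
repeat split.
- apply (aeq_trans (aeq_sym Hl)).
  rewrite (Hu 3 _ (then_mu 3 (red_mu 1 0))); exact Hr.
- apply (aeq_trans (aeq_sym Kl)).
  rewrite (Hu 1 _ (der_nil 1)); exact Hid.
- apply (aeq_trans (aeq_sym Kr)).
  rewrite (Hu 1 _ (der_nil 1)); exact Hid.
Qed.

(** * From the monad laws to unique values *)

Fixpoint collapse (n : nat) : mor (pow1 T n) T :=
  match n with
  | 0 => eta
  | S m => mu \o hcomp (idm T) (collapse m)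
  end.

Hypothesis mu_assoc : mu \o hcomp mu (idm T) =~ mu \o hcomp (idm T) mu.
Hypothesis mu_etal : mu \o hcomp eta (idm T) =~ idm T.
Hypothesis mu_etar : mu \o hcomp (idm T) eta =~ idm T.

Lemma collapse_add (a b : nat) :
  mu \o hcomp (collapse a) (collapse b) =~ collapse (a + b).
Proof.
induction a as [|a IH]; simpl.
(* Padding with identities lets interchange split off [hcomp eta (idm T)], which the left unit law
   absorbs. *)
- rewrite <- (comp_idr eta), <- (comp_idl (collapse b)), interchange.
  rewrite comp_assoc, comp_idl.
  rewrite <- (comp_idl (collapse b)) at 2.
  apply aeq_comp; [exact mu_etal|apply hcomp_idl_aeq].
(* Likewise [hcomp mu (idm T)] is split off, ready for associativity. *)
- rewrite <- (comp_idl (collapse b)), interchange, comp_assoc.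
  apply @aeq_trans with (g :=
    ((mu \o hcomp (idm T) mu)
     \o hcomp (idm T) (hcomp (collapse a) (collapse b)))).
  + apply aeq_comp; [exact mu_assoc|apply hcomp_assoc_aeq].
  + rewrite <- comp_assoc, <- interchange, comp_idl.
    apply aeq_comp; [apply aeq_refl|].
    apply aeq_hcomp; [apply aeq_refl|exact IH].
Qed.

Lemma collapse_1 : collapse 1 =~ idm T.
Proof. exact mu_etar. Qed.

(** Treats both rules at once: [n] is 2 for [mu] and 0 for [eta]. Splitting [collapse (a + 1 + b)]
    into three blocks with an identity in the middle, interchange puts [phi] there, and
    [collapse_add] reassembles the blocks. *)
Lemma collapse_around (a n b : nat) (F : cell1 C C) (phi : mor F T)
    (psi : mor (pow1 T (a + n + b)) (pow1 T (a + 1 + b))) :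
  phi =~ collapse n ->
  psi =~ hcomp (hcomp (idm (pow1 T a)) phi) (idm (pow1 T b)) ->
  collapse (a + 1 + b) \o psi = collapse (a + n + b).
Proof.
intros Hphi Hpsi; apply aeq_eq.
apply @aeq_trans with (g :=
  ((mu \o hcomp (mu \o hcomp (collapse a) (idm T)) (collapse b))
   \o hcomp (hcomp (idm (pow1 T a)) phi) (idm (pow1 T b)))).
- apply aeq_comp; [|exact Hpsi].
  apply (aeq_trans (aeq_sym (collapse_add (a + 1) b))).
  apply aeq_comp; [apply aeq_refl|].
  apply aeq_hcomp; [|apply aeq_refl].
  apply (aeq_trans (aeq_sym (collapse_add a 1))).
  apply aeq_comp; [apply aeq_refl|].
  apply aeq_hcomp; [apply aeq_refl|apply collapse_1].
- rewrite <- comp_assoc, <- interchange, <- comp_assoc, <- interchange.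
  rewrite !comp_idr, comp_idl.
  refine (aeq_trans _ (collapse_add (a + n) b)).
  apply aeq_comp; [apply aeq_refl|].
  apply aeq_hcomp; [|apply aeq_refl].
  refine (aeq_trans _ (collapse_add a n)).
  apply aeq_comp; [apply aeq_refl|].
  apply aeq_hcomp; [apply aeq_refl|exact Hphi].
Qed.

Lemma collapse_2 : mu =~ collapse 2.
Proof.
rewrite <- (comp_idr mu), <- hcomp_id.
apply aeq_comp; [apply aeq_refl|].
apply aeq_hcomp; [apply aeq_refl|apply aeq_sym, collapse_1].
Qed.

Lemma collapse_red_value (n m : nat) (r : reduction n m) :
  collapse m \o red_value mu eta r = collapse n.
Proof.
destruct r as [a b|a b].
- exact (collapse_around collapse_2 (red_mu_aeq a b)).
- assert (e : a + 0 + b = a + b) by now rewrite <- plus_n_O.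
  (* [a + 0 + b] is not convertible to [a + b]; the source of [psi] must be rewritten while [psi] is
     still quantified. *)
  pose proof (@collapse_around a 0 b _ eta) as H; revert H.
  rewrite e; intros H.
  exact (H _ (aeq_refl eta) (red_eta_aeq a b)).
Qed.

Lemma collapse_value (n m : nat) (d : derivation n m) :
  collapse m \o value mu eta d = collapse n.
Proof.
induction d as [n|n m p r d IH]; simpl; [apply comp_idr|].
now rewrite comp_assoc, IH, collapse_red_value.
Qed.

(** Composing with [collapse 1], an identity, changes nothing. The equality is heterogeneous because
    [pow1 T 1] is [T ** id1 C]. *)
Lemma value_collapse (n : nat) (d : derivation n 1) :
  value mu eta d =~ collapse n.
Proof.
rewrite <- (collapse_value d), <- (comp_idl (value mu eta d)) at 1.
apply aeq_comp; [|apply aeq_refl].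
apply (aeq_trans (aeq_idm (comp1_idr T))), aeq_sym, collapse_1.
Qed.

End Monad.

Theorem theorem4p2 (K : two_category) (C : K) (T : cell1 C C)
    (mu : mor (T ** T) T) (eta : mor (id1 C) T) :
  (mu \o whiskr mu T = cast (comp1_assoc T T T) eq_refl (mu \o whiskl T mu) /\
   cast (comp1_idl T) eq_refl (mu \o whiskr eta T) = idm T /\
   cast (comp1_idr T) eq_refl (mu \o whiskl T eta) = idm T)
  <-> terminal (X := rewrite_category mu eta) 1.
Proof.
rewrite terminal_rewriteP; split.
- intros (Ha & Hl & Hr); split; [exact derivation_to_1|].
  assert (Ha' : mu \o hcomp mu (idm T) =~ mu \o hcomp (idm T) mu)
    by exact (aeq_trans (eq_aeq Ha) (cast_aeq _ _ _)).
  assert (Hl' : mu \o hcomp eta (idm T) =~ idm T)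
    by (eexists _, _; exact Hl).
  assert (Hr' : mu \o hcomp (idm T) eta =~ idm T)
    by (eexists _, _; exact Hr).
  intros n d d'; apply aeq_eq.
  exact (aeq_trans (value_collapse Ha' Hl' Hr' d)
           (aeq_sym (value_collapse Ha' Hl' Hr' d'))).
- intros [_ Hu].
  destruct (laws_of_value_unique Hu) as (Ha & Hl & Hr).
  repeat split; apply aeq_eq.
  + exact (aeq_trans Ha (aeq_sym (cast_aeq _ _ _))).
  + exact (aeq_trans (cast_aeq _ _ _) Hl).
  + exact (aeq_trans (cast_aeq _ _ _) Hr).
Qed.
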